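(* Let $E=(x_0,\dots,x_6)$ be a major scale in $\mathbb{Z}_{12}$, with tetrads $\mathrm{I}^7,\mathrm{II}^7,\mathrm{III}^7,\mathrm{IV}^7$ on its degrees, and let $\mathcal{C}=\mathcal{X}/\!/G$ be the action groupoid of seventh chords described in the context. There is a commutative diagram in $\mathcal{C}$ (a triangular prism) relating the pair of cadential sets $(J_1,J_2)=(\{\mathrm{I}^7,\mathrm{II}^7\},\{\mathrm{I}^7,\mathrm{IV}^7\})$ and the pair $(J_3,J_4)=(\{\mathrm{II}^7,\mathrm{III}^7\},\{\mathrm{III}^7,\mathrm{IV}^7\})$, as follows. It has six vertices $$a=\mathrm{I}^7,\quad b=\mathrm{IV}^7,\quad c=\mathrm{II}^7,\qquad a'=\mathrm{III}^7,\quad b'=\mathrm{II}^7,\quad c'=\mathrm{IV}^7$$ and nine arrows, each being the morphism of $\mathcal{C}$ given by the indicated element of $G$: (first triangle, on $\mathrm{I}^7$) $a\xrightarrow{T^5}b$, $\; b\xrightarrow{R_{42}}c$, $\; a\xrightarrow{R_{42}\circ T^5}c$; (second triangle, on $\mathrm{III}^7$) $a'\xrightarrow{T^{10}}b'$, $\; b'\xrightarrow{R_{42}}c'$, $\; a'\xrightarrow{R_{42}\circ T^{10}}c'$; (connecting arrows) $a\xrightarrow{T^7\circ R_{42}}a'$, $\; b\xrightarrow{R_{42}}b'$, $\; c\xrightarrow{R_{42}}c'$. That is, each of these arrows is a morphism of $\mathcal{C}$ with the indicated domain and codomain, and any two directed paths in the diagram with the same starting vertex and the same ending vertex have equal composites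 in $\mathcal{C}$.
   Context: A major scale is a set $E=\{x_0,\dots,x_6\}\subseteq\mathbb{Z}_{12}$ of the form $x_0=t$, $x_1=t+2$, $x_2=t+4$, $x_3=t+5$, $x_4=t+7$, $x_5=t+9$, $x_6=t+11$ for a tonic $t\in\mathbb{Z}_{12}$. Its tetrads are $\{x_i,x_{i+2},x_{i+4},x_{i+6}\}$ (indices mod 7), $i=0,\dots,6$, denoted $\mathrm{I}^7,\mathrm{II}^7,\dots,\mathrm{VII}^7$ respectively. A seventh chord is regarded as a 4-element subset of $\mathbb{Z}_{12}$; an underline marks its root. $\mathcal{X}$ is the set of all dominant seventh chords $\{\underline{r},r+4,r+7,r+10\}$, minor seventh chords $\{\underline{r},r+3,r+7,r+10\}$, half-diminished seventh chords $\{\underline{r},r+3,r+6,r+10\}$, major seventh chords $\{\underline{r},r+4,r+7,r+11\}$ and diminished seventh chords $\{\underline{r},r+3,r+6,r+9\}$, $r\in\mathbb{Z}_{12}$. $T^s$ ($s\in\mathbb{Z}_{12}$) is the permutation of $\mathcal{X}$ given by transposition, i.e. adding $s$ to every element of a chord. $R_{42}$ is the permutation of $\mathcal{X}$ that exchanges major and minor seventh chords by $$R_{42}:\ [\underline{x},x+4,x+7,x+11]\leftrightarrow[x,x+4,x+7,\underline{x+9}]\qquad(x\in\mathbb{Z}_{12})$$ (so the major seventh chord with root $x$ is exchanged with the minor seventh chord with root $x+9$), and fixes every chord of the other types. $PLRQ$ is the PLRQ group of Cannas et al. (2017), a group of permutations of $\mathcal{X}$ whose generators exchange specified pairs of chord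 types and fix the remaining types; $R_{42}$ is one of its elements. $G$ is the group of permutations of $\mathcal{X}$ generated by $PLRQ$ and all $T^s$, $s\in\mathbb{Z}_{12}$. Of $G$, the statement involves only the elements generated by $R_{42}$ and the $T^s$. The action groupoid $\mathcal{C}=\mathcal{X}/\!/G$ has the elements of $\mathcal{X}$ as objects; a morphism $X\to Y$ is a pair $(g,X)$ with $g\in G$ and $g(X)=Y$; composition is $(h,g(X))\circ(g,X)=(hg,X)$. The morphism $(g,X)$ is written $g:X\to g(X)$; thus two morphisms with the same domain are equal if and only if their group elements are equal. *)

(* Defs.v *)
From mathcomp Require Import all_boot all_order all_algebra all_fingroup.

Set Implicit Arguments.
Unset Strict Implicit.
Unset Printing Implicit Defensive.

Import GRing.Theory.
Local Open Scope ring_scope.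

(* A set of pitch classes together with its marked (underlined) root.  The
   mark matters only for diminished seventh chords: the four chords
   {r, r+3, r+6, r+9} with the same underlying set are told apart by it, which
   is what allows diminished chords to be exchanged bijectively with chords of
   another type.  Roots of all other types are determined by the set. *)
Definition rooted_set : Type := ({set 'Z_12} * 'Z_12)%type.

Definition stacked (a b c r : 'Z_12) : rooted_set :=
  ([set r; r + a; r + b; r + c], r).

Definition dom7 : 'Z_12 -> rooted_set := stacked 4 7 10.
Definition min7 : 'Z_12 -> rooted_set := stacked 3 7 10.
Definition hdim7 : 'Z_12 -> rooted_set := stacked 3 6 10.
Definition maj7 : 'Z_12 -> rooted_set := stacked 4 7 11.
Definition dim7 : 'Z_12 -> rooted_set := stacked 3 6 9.

Definition is_seventh (c : rooted_set) : bool :=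
  [exists r, [|| c == dom7 r, c == min7 r, c == hdim7 r, c == maj7 r
              | c == dim7 r]].

Definition chord : Type := {c : rooted_set | is_seventh c}.

Definition transpose (s : 'Z_12) (c : rooted_set) : rooted_set :=
  ([set x + s | x in c.1], c.2 + s).

Lemma transpose_stacked s a b c r :
  transpose s (stacked a b c r) = stacked a b c (r + s).
Proof.
rewrite /transpose /stacked /=; congr pair.
by rewrite !imsetU !imset_set1 ![_ + _ + s]addrAC.
Qed.

Lemma transpose_seventh s c : is_seventh c -> is_seventh (transpose s c).
Proof.
case/existsP=> r H; apply/existsP; exists (r + s); move: H.
by do 4?[case/orP]; move/eqP->; rewrite transpose_stacked eqxx ?orbT.
Qed.

Definition transpose_chord (s : 'Z_12) (c : chord) : chord :=
  exist _ (transpose s (val c)) (transpose_seventh s (valP c)).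

Lemma transpose_chord_inj s : injective (transpose_chord s).
Proof.
move=> c d /(congr1 val) /= E; apply: val_inj.
rewrite (surjective_pairing (val c)) (surjective_pairing (val d)).
rewrite (@addIr _ s _ _ (congr1 snd E)).
by rewrite (imset_inj (@addIr _ s) (congr1 fst E)).
Qed.

Definition T (s : 'Z_12) : {perm chord} := perm (@transpose_chord_inj s).

(* [x, x+4, x+7, x+11] with root x  <->  [x, x+4, x+7, x+9] with root x+9 *)
Definition R42_rooted (c : rooted_set) : rooted_set :=
  if [pick x | c == maj7 x] is Some x then min7 (x + 9)
  else if [pick x | c == min7 (x + 9)] is Some x then maj7 x
  else c.

Lemma maj7_neq_min7 x y : maj7 x != min7 y.
Proof.
apply/eqP=> E; have /= xy := congr1 snd E.
move/(congr1 fst): E; rewrite /= -{}xy => E.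
have: x + 4 \in [set x; x + 4; x + 7; x + 11] by rewrite !inE eqxx ?orbT.
rewrite {}E !inE -[X in _ == X]addr0.
by rewrite !(inj_eq (addrI x)).
Qed.

Lemma R42_maj7 x : R42_rooted (maj7 x) = min7 (x + 9).
Proof.
rewrite /R42_rooted; case: pickP => [y /eqP /(congr1 snd) /= -> //|/(_ x)].
by rewrite eqxx.
Qed.

Lemma R42_min7 x : R42_rooted (min7 (x + 9)) = maj7 x.
Proof.
rewrite /R42_rooted; case: pickP => [y|_].
  by rewrite eq_sym (negPf (maj7_neq_min7 _ _)).
case: pickP => [y /eqP /(congr1 snd) /= E|/(_ x)].
  by rewrite (@addIr _ 9 _ _ E).
by rewrite eqxx.
Qed.

Lemma min7_maj7_set (x : 'Z_12) : min7 (x + 9) = ([set x; x + 4; x + 7; x + 9], x + 9).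
Proof.
have E (a b : 'Z_12) : 9 + a = b -> x + 9 + a = x + b.
  by move=> <-; rewrite (addrA x 9 a).
rewrite /min7 /stacked (E 3 0) ?(E 7 4) ?(E 10 7) ?addr0; try exact: val_inj.
by congr pair; apply/setP=> y; rewrite !inE; do 4![case: (y == _)].
Qed.

Lemma R42_rooted_other c :
  (forall x, c != maj7 x) -> (forall x, c != min7 x) -> R42_rooted c = c.
Proof.
move=> nM nm; rewrite /R42_rooted.
case: pickP => [x|_]; first by rewrite (negPf (nM x)).
by case: pickP => // x; rewrite (negPf (nm _)).
Qed.

Lemma R42_rootedK : involutive R42_rooted.
Proof.
move=> c.
case: (pickP (fun x => c == maj7 x)) => [x /eqP->|nM].
  by rewrite R42_maj7 R42_min7.
case: (pickP (fun x => c == min7 x)) => [x /eqP->|nm].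
  by rewrite -(subrK 9 x) R42_min7 R42_maj7.
have nM' x : c != maj7 x by rewrite nM.
have nm' x : c != min7 x by rewrite nm.
by rewrite !R42_rooted_other.
Qed.

Lemma R42_seventh c : is_seventh c -> is_seventh (R42_rooted c).
Proof.
move=> Hc; rewrite /R42_rooted.
case: pickP => [x _|_].
  by apply/existsP; exists (x + 9); rewrite eqxx ?orbT.
case: pickP => [x _|_] //.
by apply/existsP; exists x; rewrite eqxx ?orbT.
Qed.

Definition R42_chord (c : chord) : chord :=
  exist _ (R42_rooted (val c)) (R42_seventh (valP c)).

Lemma R42_chord_inj : injective R42_chord.
Proof.
move=> c d /(congr1 val) /= E; apply: val_inj.
by rewrite -(R42_rootedK (val c)) E R42_rootedK.
Qed.

Definition R42 : {perm chord} := perm R42_chord_inj.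

(* In {perm _} the product s * t applies s first. *)
Definition pcompose (h g : {perm chord}) : {perm chord} := (g * h)%g.

Lemma pcomposeE h g c : pcompose h g c = h (g c).
Proof. exact: permM. Qed.

(* The argument stands for the PLRQ group; it is kept arbitrary since only the
   elements generated by R42 and the T s matter below. *)
Definition extended_group (PLRQ : {group {perm chord}}) : {group {perm chord}} :=
  <<PLRQ :|: [set T s | s : 'Z_12]>>%G.

Section ActionGroupoid.

Variable G : {group {perm chord}}.

Record mor (X Y : chord) : Type := Mor {
  mor_elt : {perm chord};
  mor_mem : mor_elt \in G;
  mor_map : mor_elt X = Y
}.

Lemma mor_inj X Y (f g : mor X Y) : mor_elt f = mor_elt g -> f = g.
Proof.
case: f g => [f fG fX] [g gG gX] /= E; subst g.
by congr Mor; apply: eq_irrelevance.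
Qed.

Definition mor_id X : mor X X := Mor (group1 G) (perm1 X).

Lemma mor_comp_mem X Y Z (h : mor Y Z) (g : mor X Y) :
  pcompose (mor_elt h) (mor_elt g) \in G.
Proof. by rewrite groupM ?mor_mem. Qed.

Lemma mor_comp_map X Y Z (h : mor Y Z) (g : mor X Y) :
  pcompose (mor_elt h) (mor_elt g) X = Z.
Proof. by rewrite pcomposeE !mor_map. Qed.

Definition mor_comp X Y Z (h : mor Y Z) (g : mor X Y) : mor X Z :=
  Mor (mor_comp_mem h g) (mor_comp_map h g).

End ActionGroupoid.

Section Diagrams.

Variables (V : Type) (A : V -> V -> Type).

Inductive dpath (u : V) : V -> Type :=
| dnil : dpath u u
| drcons v w : dpath u v -> A v w -> dpath u w.

Variables (G : {group {perm chord}}) (ob : V -> chord).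
Variable arr : forall u v, A u v -> mor G (ob u) (ob v).

Fixpoint composite u v (p : dpath u v) : mor G (ob u) (ob v) :=
  match p in dpath _ v return mor G (ob u) (ob v) with
  | dnil => mor_id G (ob u)
  | drcons _ _ q e => mor_comp (arr e) (composite q)
  end.

Definition commutes : Prop :=
  forall u v (p q : dpath u v), composite p = composite q.

End Diagrams.

Definition scale_steps : seq 'Z_12 := [:: 0; 2; 4; 5; 7; 9; 11].

Definition major_scale (t : 'Z_12) (i : 'Z_7) : 'Z_12 := t + scale_steps`_i.

Definition tetrad_rooted (E : 'Z_7 -> 'Z_12) (i : 'Z_7) : rooted_set :=
  ([set E i; E (i + 2); E (i + 4); E (i + 6)], E i).

Lemma tetrad_stacked t (i : 'Z_7) (a b c : 'Z_12) :
  scale_steps`_(i + 2)%R = scale_steps`_i + a ->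
  scale_steps`_(i + 4)%R = scale_steps`_i + b ->
  scale_steps`_(i + 6)%R = scale_steps`_i + c ->
  tetrad_rooted (major_scale t) i = stacked a b c (major_scale t i).
Proof.
by move=> Ea Eb Ec; rewrite /tetrad_rooted /stacked /major_scale Ea Eb Ec !addrA.
Qed.

Lemma tetrad_seventh t i : is_seventh (tetrad_rooted (major_scale t) i).
Proof.
apply/existsP; exists (major_scale t i).
case: i => [[|[|[|[|[|[|[|m]]]]]]] Hi] //.
- by rewrite (@tetrad_stacked _ _ 4 7 11) ?eqxx ?orbT //; exact: val_inj.
- by rewrite (@tetrad_stacked _ _ 3 7 10) ?eqxx ?orbT //; exact: val_inj.
- by rewrite (@tetrad_stacked _ _ 3 7 10) ?eqxx ?orbT //; exact: val_inj.
- by rewrite (@tetrad_stacked _ _ 4 7 11) ?eqxx ?orbT //; exact: val_inj.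
- by rewrite (@tetrad_stacked _ _ 4 7 10) ?eqxx ?orbT //; exact: val_inj.
- by rewrite (@tetrad_stacked _ _ 3 7 10) ?eqxx ?orbT //; exact: val_inj.
- by rewrite (@tetrad_stacked _ _ 3 6 10) ?eqxx ?orbT //; exact: val_inj.
Qed.

(* tetrad t 0, ..., tetrad t 6 are I^7, ..., VII^7 of the scale with tonic t *)
Definition tetrad (t : 'Z_12) (i : 'Z_7) : chord :=
  exist _ (tetrad_rooted (major_scale t) i) (tetrad_seventh t i).

Inductive prism_vertex : Type := va | vb | vc | va' | vb' | vc'.

Inductive prism_arrow : prism_vertex -> prism_vertex -> Type :=
| ab : prism_arrow va vb
| bc : prism_arrow vb vc
| ac : prism_arrow va vc
| ab' : prism_arrow va' vb'
| bc' : prism_arrow vb' vc'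
| ac' : prism_arrow va' vc'
| aa' : prism_arrow va va'
| bb' : prism_arrow vb vb'
| cc' : prism_arrow vc vc'.

Definition prism_ob (t : 'Z_12) (v : prism_vertex) : chord :=
  match v with
  | va => tetrad t 0
  | vb => tetrad t 3
  | vc => tetrad t 1
  | va' => tetrad t 2
  | vb' => tetrad t 1
  | vc' => tetrad t 3
  end.

(* Main.v *)
(** [R42] is an involution commuting with every transposition.  Hence each
    vertex [v] of the prism carries an element [phi v] such that every arrow
    [u -> v] has group element [h] with [phi v = h \o phi u]; the group element
    of any path from [u] to [v] is then determined by [phi u] and [phi v]. *)

Require Import Defs.
From mathcomp Require Import all_boot all_order all_algebra all_fingroup.
Local Open Scope ring_scope.

Set Implicit Arguments.
Unset Strict Implicit.
Unset Printing Implicit Defensive.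

Import GRing.Theory.

Lemma T_add (r s : 'Z_12) : (T r * T s)%g = T (r + s).
Proof.
apply/permP=> c; rewrite permM !permE; apply: val_inj.
rewrite /= /transpose /= addrA -imset_comp; congr pair.
by apply: eq_imset => x /=; rewrite addrA.
Qed.

Lemma R42_sqr : (R42 * R42)%g = 1%g.
Proof.
by apply/permP=> c; rewrite permM !permE; apply: val_inj; rewrite /= R42_rootedK.
Qed.

Lemma transposeK s : cancel (transpose s) (transpose (- s)).
Proof.
move=> [A r]; rewrite /transpose /= addrK -imset_comp; congr pair.
by rewrite -[RHS]imset_id; apply: eq_imset => x /=; rewrite addrK.
Qed.

(** Transposition preserves the chord type and shifts the root, while [R42_rooted] shifts roots by a
    constant depending only on the type, so the two shifts commute. *)
Lemma R42_rooted_transpose s c :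
  R42_rooted (transpose s c) = transpose s (R42_rooted c).
Proof.
case: (pickP (fun x => c == maj7 x)) => [x /eqP->|nM].
  by rewrite transpose_stacked !R42_maj7 transpose_stacked addrAC.
case: (pickP (fun x => c == min7 x)) => [x /eqP->|nm].
  (* Writing the root as [x - 9 + 9] puts the minor chord in the form that [R42_min7] handles. *)
  rewrite -(subrK 9 x) transpose_stacked addrAC !R42_min7.
  by rewrite transpose_stacked.
(* If the transposed chord were major or minor, transposing back by [- s] would make [c] itself
   so. *)
rewrite !R42_rooted_other // => x; rewrite ?nM ?nm //;
  apply/eqP=> /(congr1 (transpose (- s))); rewrite transposeK transpose_stacked.
- by move/eqP; rewrite nM.
- by move/eqP; rewrite nm.
Qed.

Lemma R42_T s : (R42 * T s)%g = (T s * R42)%g.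
Proof.
apply/permP=> c; rewrite !permM !permE; apply: val_inj.
by rewrite /= R42_rooted_transpose.
Qed.

(** The relation telescopes along a path: any composite from [u] to [w] has group element
    [(phi u)^-1 * phi w], whichever path is taken. *)
Lemma commutes_potential (V : Type) (A : V -> V -> Type)
    (G : {group {perm chord}}) (ob : V -> chord)
    (arr : forall u v, A u v -> mor G (ob u) (ob v)) (phi : V -> {perm chord}) :
    (forall u v (e : A u v), phi v = pcompose (mor_elt (arr u v e)) (phi u)) ->
  commutes arr.
Proof.
move=> phi_arr u v p q; apply: mor_inj.
suff H w (r : dpath A u w) : (phi u * mor_elt (composite arr r))%g = phi w.
  by apply: (mulgI (phi u)); rewrite !H.
elim: r => [|x y r IHr e] /=; first by rewrite mulg1.
by rewrite (phi_arr _ _ e) -IHr /pcompose mulgA.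
Qed.

(** Naming the type and root of the four tetrads involved reduces each check of an arrow's endpoints
    to arithmetic on roots modulo 12. *)
Lemma tetrad0 t : val (tetrad t 0) = maj7 t.
Proof.
rewrite /= (@tetrad_stacked _ _ 4 7 11); try exact: val_inj.
by rewrite /major_scale addr0.
Qed.

Lemma tetrad1 t : val (tetrad t 1) = min7 (t + 2).
Proof. by rewrite /= (@tetrad_stacked _ _ 3 7 10) //; exact: val_inj. Qed.

Lemma tetrad2 t : val (tetrad t 2) = min7 (t + 4).
Proof. by rewrite /= (@tetrad_stacked _ _ 3 7 10) //; exact: val_inj. Qed.

Lemma tetrad3 t : val (tetrad t 3) = maj7 (t + 5).
Proof. by rewrite /= (@tetrad_stacked _ _ 4 7 11) //; exact: val_inj. Qed.

Lemma T_tetrad0 t : T 5 (tetrad t 0) = tetrad t 3.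
Proof.
rewrite permE; apply: val_inj; rewrite tetrad3 [LHS]/= [tetrad_rooted _ _]tetrad0.
by rewrite transpose_stacked.
Qed.

Lemma T_tetrad2 t : T 10 (tetrad t 2) = tetrad t 1.
Proof.
rewrite permE; apply: val_inj; rewrite tetrad1 [LHS]/= [tetrad_rooted _ _]tetrad2.
(* 4 + 10 = 2 modulo 12. *)
by rewrite transpose_stacked -addrA; congr (min7 (t + _)); apply: val_inj.
Qed.

Lemma R42_tetrad3 t : R42 (tetrad t 3) = tetrad t 1.
Proof.
rewrite permE; apply: val_inj; rewrite tetrad1 [LHS]/= [tetrad_rooted _ _]tetrad3.
(* 5 + 9 = 2 modulo 12. *)
by rewrite R42_maj7 -addrA; congr (min7 (t + _)); apply: val_inj.
Qed.

Lemma R42_tetrad1 t : R42 (tetrad t 1) = tetrad t 3.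
Proof. by rewrite -R42_tetrad3 -permM R42_sqr perm1. Qed.

Lemma T_R42_tetrad0 t : T 7 (R42 (tetrad t 0)) = tetrad t 2.
Proof.
rewrite !permE; apply: val_inj; rewrite tetrad2 [LHS]/= [tetrad_rooted _ _]tetrad0.
rewrite R42_maj7 transpose_stacked -addrA.
(* 9 + 7 = 4 modulo 12. *)
by congr (min7 (t + _)); apply: val_inj.
Qed.

Definition prism_elt u v (e : prism_arrow u v) : {perm chord} :=
  match e with
  | ab => T 5
  | ac => pcompose R42 (T 5)
  | ab' => T 10
  | ac' => pcompose R42 (T 10)
  | aa' => pcompose (T 7) R42
  | bc | bc' | bb' | cc' => R42
  end.

Lemma prism_elt_map t u v (e : prism_arrow u v) :
  prism_elt e (prism_ob t u) = prism_ob t v.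
Proof.
by case: e; rewrite /= ?pcomposeE ?T_tetrad0 ?T_tetrad2 ?T_R42_tetrad0
  ?R42_tetrad3 ?R42_tetrad1.
Qed.

Lemma prism_elt_mem (PLRQ : {group {perm chord}}) u v (e : prism_arrow u v) :
  R42 \in PLRQ -> prism_elt e \in extended_group PLRQ.
Proof.
move=> hR42.
have RG : R42 \in extended_group PLRQ by rewrite mem_gen // inE hR42.
have TG s : T s \in extended_group PLRQ.
  by rewrite mem_gen // inE imset_f ?orbT.
by case: e; rewrite /= ?groupM.
Qed.

(** Every vertex is reachable from [va], and the value at [v] is the composite along a path from
    [va]; at [vc'] the path through [vb] and [vb'] gives [R42] twice after [T 5], hence [T 5]. *)
Definition prism_potential (v : prism_vertex) : {perm chord} :=
  match v with
  | va => 1%g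
  | vb | vc' => T 5
  | vc | vb' => pcompose R42 (T 5)
  | va' => pcompose (T 7) R42
  end.

Lemma prism_potential_arrow u v (e : prism_arrow u v) :
  prism_potential v = pcompose (prism_elt e) (prism_potential u).
Proof.
have T17 : (T 7 * T 10)%g = T 5 by rewrite T_add; congr T; apply: val_inj.
case: e; rewrite /= /pcompose ?mul1g //.
(* The arrows left are [ab'], [bc'], [ac'] and [cc'], in this order; the others hold by the choice
   of potential. *)
- by rewrite -mulgA T17 R42_T.
- by rewrite -mulgA R42_sqr mulg1.
- by rewrite mulgA -(mulgA R42) T17 R42_T -mulgA R42_sqr mulg1.
- by rewrite -mulgA R42_sqr mulg1.
Qed.

Theorem theorem5p1 (PLRQ : {group {perm chord}}) (hR42 : R42 \in PLRQ)
    (t : 'Z_12) :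
  exists arr : forall u v, prism_arrow u v ->
      mor (extended_group PLRQ) (prism_ob t u) (prism_ob t v),
    [/\ mor_elt (arr va vb ab) = T 5,
        mor_elt (arr vb vc bc) = R42
      & mor_elt (arr va vc ac) = pcompose R42 (T 5)] /\
    [/\ mor_elt (arr va' vb' ab') = T 10,
        mor_elt (arr vb' vc' bc') = R42
      & mor_elt (arr va' vc' ac') = pcompose R42 (T 10)] /\
    [/\ mor_elt (arr va va' aa') = pcompose (T 7) R42,
        mor_elt (arr vb vb' bb') = R42
      & mor_elt (arr vc vc' cc') = R42] /\
    commutes arr.
Proof.
exists (fun u v e => Mor (prism_elt_mem e hR42) (prism_elt_map t e)).
do 3![split; first by []].
by apply: (@commutes_potential _ _ _ _ _ prism_potential) => u v e;
  apply: prism_potential_arrow.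
Qed.
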